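(* Let $\mathbf{k}$ be a commutative ring, $n$ a positive integer and $q\in\mathbf{k}$ invertible. For $I,K\subseteq[n-1]$, the coefficient of $\mathbf{B}_K$ in the expansion of $\mathbf{V}_n^{(q)}\mathbf{B}_I$ in the $\mathbf{B}$-basis of $\Sigma_n$ is $0$ if $I\not\subseteq K$, and if $I\subseteq K$ it equals \[ [\mathbf{B}_K]\,\mathbf{V}_n^{(q)}\mathbf{B}_I=(-1)^{|K|}\,q^{n-1}\,(1-q^{-1})^{|I|}\prod_{v\in\overline{K|I}}[v]_{q^{-1}}, \] where the product runs over the entries of the sequence $\overline{K|I}$ (with multiplicity) and $[v]_r=r^0+r^1+\cdots+r^{v-1}$.
   Context: $[m]=\{1,\dots,m\}$; $S_n$ is the symmetric group on $[n]$, and products in $\mathbf{k}S_n$ are given by composition, $(\pi\sigma)(i)=\pi(\sigma(i))$. $\operatorname{Des}(\pi)=\{i\in[n-1]:\pi(i)>\pi(i+1)\}$. For $I\subseteq[n-1]$: $\mathbf{D}_I=\sum_{\operatorname{Des}(\pi)=I}\pi$ and $\mathbf{B}_I=\sum_{\operatorname{Des}(\pi)\subseteq I}\pi$; these form two bases of the descent algebra $\Sigma_n\subseteq\mathbf{k}S_n$, and $[\mathbf{B}_K]f$ is the coefficient of $\mathbf{B}_K$ in $f$. A V-permutation is $w\in S_n$ with $w(1)>\cdots>w(k)<w(k+1)<\cdots<w(n)$ for some $k\in[n]$; $\mathbf{V}_n^{(q)}=\sum_{w\text{ V-permutation}}(-q)^{w^{-1}(1)-1}w$. For $I=\{i_1<\dots<i_p\}\subseteq[n-1]$,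 $\operatorname{comp}(I)=(i_1,i_2-i_1,\dots,n-i_p)$. If $I\subseteq K$, $\operatorname{comp}(K)$ splits uniquely into consecutive blocks whose sums are the successive entries of $\operatorname{comp}(I)$; $\overline{K|I}$ is the sequence of the last entries of these blocks (length $|I|+1$). *)

(* Defs.v *)
From mathcomp Require Import all_boot all_order all_algebra all_fingroup.

Set Implicit Arguments.
Unset Strict Implicit.
Unset Printing Implicit Defensive.

Import GRing.Theory.
Local Open Scope ring_scope.

(* Throughout n = m.+1, so that S_n is 'S_m.+1 acting on 'I_m.+1, whose element
   x stands for x.+1 in [n].  Subsets of [n-1] are {set 'I_m}, where j : 'I_m
   stands for the position j.+1 in [n-1]; the consecutive positions j.+1 and
   j.+2 of [n] are then lift ord_max j and lift ord0 j. *)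

Section GroupAlgebra.
Variables (k : comPzRingType) (m : nat).

Definition galg := {ffun 'S_m.+1 -> k^o}.

Definition gbasis (w : 'S_m.+1) : galg := [ffun u => (u == w)%:R].

(* (p s)(i) = p (s i) is MathComp's s * p, see permM. *)
Definition gmul (f g : galg) : galg :=
  \sum_(p : 'S_m.+1) \sum_(s : 'S_m.+1) ((f p : k) * (g s : k)) *: gbasis (s * p)%g.

Definition Des (w : 'S_m.+1) : {set 'I_m} :=
  [set j : 'I_m | (w (lift ord0 j) < w (lift ord_max j))%N].

Definition Bel (I : {set 'I_m}) : galg :=
  \sum_(w : 'S_m.+1 | Des w \subset I) gbasis w.

Definition Bexpansion (f : galg) (c : {ffun {set 'I_m} -> k}) : Prop :=
  f = \sum_(K : {set 'I_m}) c K *: Bel K.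

Definition Vperm (w : 'S_m.+1) : bool :=
  [exists t : 'I_m.+1, forall j : 'I_m,
     if (j < t)%N then (w (lift ord0 j) < w (lift ord_max j))%N
     else (w (lift ord_max j) < w (lift ord0 j))%N].

(* The exponent w^{-1}(1) - 1 is the 0-based value of w^-1 at ord0. *)
Definition Vel (q : k) : galg :=
  \sum_(w : 'S_m.+1 | Vperm w) (- q) ^+ ((w^-1)%g ord0) *: gbasis w.

End GroupAlgebra.

Section Compositions.
Variable m : nat.

(* enum I lists I in increasing order. *)
Definition comp_set (I : {set 'I_m}) : seq nat :=
  pairmap (fun a b => b - a)%N 0%N (rcons [seq (val j).+1 | j <- enum I] m.+1).

(* Cuts s into consecutive blocks with the prescribed successive sums, each
   block being the shortest prefix of what remains that has the right sum. *)
Fixpoint blocks (sums s : seq nat) : seq (seq nat) :=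
  if sums is a :: sums' then
    let l := find (fun j => sumn (take j s) == a) (iota 0 (size s).+1) in
    take l s :: blocks sums' (drop l s)
  else [::].

Definition last_entries (K I : {set 'I_m}) : seq nat :=
  [seq last 0%N b | b <- blocks (comp_set I) (comp_set K)].

End Compositions.

Definition qint (k : comPzRingType) (v : nat) (r : k) : k :=
  \sum_(j < v) r ^+ j.

(* Main.v *)
Require Import Defs.
From mathcomp Require Import all_boot all_order all_algebra all_fingroup.
From mathcomp Require Import zify.
Import GRing.Theory.
Local Open Scope ring_scope.
Set Implicit Arguments.
Unset Strict Implicit.
Unset Printing Implicit Defensive.

(** The coefficient of a permutation u in V B_I is the sum of
    (-q)^(position of the minimum) over the V-permutations p that are shuffles
    of the blocks into which I cuts the word u.  A V-permutation is determined
    by the set of letters to the left of its minimum; being such a shuffle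
    forces a letter into this set at each descent of u outside I, forces the
    next letter out of it at each ascent outside I, and forces the minimum out.
    Exactly |I| letters remain free, so with J = Des u the coefficient is
    (-q)^|J \ I| (1 - q)^|I| if I u J meets every block in an initial segment,
    and 0 otherwise.

    On the other side, q^(n-1) prod_v [v]_(1/q) is the sum of q^|T| over the
    sets T containing K that meet every block in an initial segment, and
    inclusion-exclusion collapses the sum over the K containing I u J to the
    single term T = I u J. *)

(** * Permutations sorting a key *)

Section RankPerm.
Variables (m : nat) (key : 'I_m -> nat).
Hypothesis key_inj : injective key.

Lemma rank_subproof x : (#|[set y | (key y < key x)%N]| < m)%N.
Proof.
rewrite -[X in (_ < X)%N]card_ord -cardsT; apply: proper_card.
by apply/properP; split; [exact: subsetT | exists x; rewrite ?inE ?ltnn].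
Qed.

Definition rank x : 'I_m := Ordinal (rank_subproof x).

Lemma ltn_rank x y : (rank x < rank y)%N = (key x < key y)%N.
Proof.
have lt_rank a b : (key a < key b)%N -> (rank a < rank b)%N.
  move=> lab; apply: proper_card; apply/properP; split.
    by apply/subsetP=> c; rewrite !inE => /ltn_trans; apply.
  by exists a; rewrite !inE ?ltnn.
case: (ltngtP (key x) (key y)) => [/lt_rank -> // | /lt_rank /ltnW | /key_inj ->].
  by rewrite leqNgt => /negbTE.
by rewrite ltnn.
Qed.

Lemma rank_inj : injective rank.
Proof.
move=> x y exy; apply: key_inj; case: (ltngtP (key x) (key y)) => //.
  by rewrite -ltn_rank exy ltnn.
by rewrite -ltn_rank exy ltnn.
Qed.

Definition rank_perm : {perm 'I_m} := perm rank_inj.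

Lemma ltn_rank_perm x y : (rank_perm x < rank_perm y)%N = (key x < key y)%N.
Proof. by rewrite !permE ltn_rank. Qed.

Lemma rank_permE x : rank_perm x = #|[set y | (key y < key x)%N]| :> nat.
Proof. by rewrite permE. Qed.

End RankPerm.

Lemma card_perm_lt m (t : {perm 'I_m}) x : #|[set y | (t y < t x)%N]| = t x.
Proof.
have -> : [set y | (t y < t x)%N] = t @^-1: [set z : 'I_m | (z < t x)%N].
  by apply/setP=> y; rewrite !inE.
rewrite (card_preimset _ (@perm_inj _ t)) -sum1dep_card.
by rewrite (big_ord_narrow (ltnW (ltn_ord (t x)))) /= sum1_card card_ord.
Qed.

Lemma perm_ltn_inj m (t t' : {perm 'I_m}) :
  (forall x y, (t x < t y)%N = (t' x < t' y)%N) -> t = t'.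
Proof.
move=> tt'; apply/permP=> x; apply: val_inj; rewrite /= -(card_perm_lt t x) -(card_perm_lt t' x).
by apply: eq_card => y; rewrite !inE tt'.
Qed.

(** * Coefficients in the group algebra *)

Section GroupAlgebraCoef.
Variables (k : comPzRingType) (m : nat).
Implicit Types (f g : galg k m) (u : 'S_m.+1) (I J : {set 'I_m}).

Lemma sum_gbasisE (P : pred 'S_m.+1) (F : 'S_m.+1 -> k) u :
  ((\sum_(w | P w) F w *: gbasis k w) : galg k m) u = if P u then F u else 0.
Proof.
rewrite sum_ffunE.
under eq_bigr => w _ do rewrite !ffunE.
case: ifP => Pu.
  rewrite (bigD1 u) //= eqxx big1 ?addr0; first exact: mulr1.
  by move=> w /andP[_ /negbTE wu]; rewrite eq_sym wu; apply: mulr0.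
apply: big1 => w Pw; case: eqP => [e|_]; last exact: mulr0.
by rewrite -e Pu in Pw.
Qed.

Lemma BelE I u : Bel k I u = (Des u \subset I)%:R.
Proof.
rewrite /Bel; under eq_bigr => w _ do rewrite -[gbasis k w]scale1r.
by rewrite sum_gbasisE; case: ifP.
Qed.

Lemma VelE q u : Vel m q u = if Vperm u then (- q) ^+ (u^-1 ord0)%g else 0 :> k.
Proof. by rewrite /Vel sum_gbasisE. Qed.

(** The product $ps$ under composition is [(s * p)%g], so the pairs with product [u] are those with
    [s = (u * p^-1)%g]. *)
Lemma gmulE f g u : gmul f g u = \sum_p (f p : k) * (g (u * p^-1)%g : k) :> k.
Proof.
rewrite /gmul sum_ffunE; apply: eq_bigr => p _; rewrite sum_ffunE.
rewrite (bigD1 (u * p^-1)%g) //= !ffunE mulgKV eqxx big1 ?addr0.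
  exact: mulr1.
move=> s ne; rewrite !ffunE; case: eqP => [e|_]; last exact: mulr0.
by rewrite e mulgK eqxx in ne.
Qed.

End GroupAlgebraCoef.

(** * Last entries and block-final sets *)

Definition block_lasts (sums s : seq nat) : seq nat :=
  [seq last 0%N b | b <- blocks sums s].

(** As [b > 0], the empty prefix of [b :: s] has sum 0, not [a + b]. A prefix with the right sum
    starts with [b] and leaves the sum [a] to be found in [s]. *)
Lemma find_prefix_sum a b s : (0 < b)%N ->
  find (fun j => sumn (take j (b :: s)) == a + b)%N (iota 0 (size (b :: s)).+1) =
  (find (fun j => sumn (take j s) == a) (iota 0 (size s).+1)).+1.
Proof.
move=> b0; rewrite -[(size _).+1]add1n iotaD add0n (iotaDl 1 0) /=.
rewrite ltn_eqF ?addn_gt0 ?b0 ?orbT // find_map; congr _.+1.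
rewrite [in RHS]/= take0 /=.
rewrite addn0 -[X in X == _]add0n eqn_add2r; congr (if _ then _ else _.+1).
by rewrite !(iotaDl 1 0) !find_map; apply: eq_find => j /=; rewrite addnC eqn_add2r.
Qed.

Lemma blocks_cons a sums s : blocks (a :: sums) s =
  let l := find (fun j => sumn (take j s) == a) (iota 0 (size s).+1) in
  take l s :: blocks sums (drop l s).
Proof. by []. Qed.

Lemma block_lasts_eq a sums s : (0 < a)%N ->
  block_lasts (a :: sums) (a :: s) = a :: block_lasts sums s.
Proof.
move=> a0; rewrite /block_lasts blocks_cons.
have := find_prefix_sum 0 s a0; rewrite add0n => -> /=.
by rewrite take0 /= take0 drop0.
Qed.

(** Since [a > 0], the first block does not stop right after [b]: it contains [c] too, and removing
    [b] keeps its last entry. *)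
Lemma block_lasts_add a b sums c s : (0 < a)%N -> (0 < b)%N ->
  block_lasts (a + b :: sums)%N (b :: c :: s) = block_lasts (a :: sums) (c :: s).
Proof.
move=> a0 b0; rewrite /block_lasts !blocks_cons find_prefix_sum //.
by rewrite /= take0 (ltn_eqF a0).
Qed.

(** * Recursion on the first position of a subset *)

Definition tail_set m (A : {set 'I_m.+1}) : {set 'I_m} := [set j | lift ord0 j \in A].

Definition cons_set m (b : bool) (A : {set 'I_m}) : {set 'I_m.+1} :=
  [set j | if unlift ord0 j is Some i then i \in A else b].

Lemma ord0_cons_set m b (A : {set 'I_m}) : (ord0 \in cons_set b A) = b.
Proof. by rewrite inE unlift_none. Qed.

Lemma lift0_cons_set m b (A : {set 'I_m}) j : (lift ord0 j \in cons_set b A) = (j \in A).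
Proof. by rewrite inE liftK. Qed.

Lemma cons_setK m b (A : {set 'I_m}) : tail_set (cons_set b A) = A.
Proof. by apply/setP=> j; rewrite inE lift0_cons_set. Qed.

Lemma tail_setK m (A : {set 'I_m.+1}) : cons_set (ord0 \in A) (tail_set A) = A.
Proof. by apply/setP=> j; rewrite inE; case: unliftP => [i|] ->; rewrite ?inE. Qed.

Lemma enum_tail_set m (A : {set 'I_m.+1}) :
  enum A = nseq (ord0 \in A) ord0 ++ [seq lift ord0 j | j <- enum (tail_set A)].
Proof.
have enumE n (B : {set 'I_n}) : enum B = [seq x <- enum 'I_n | x \in B].
  by rewrite enumT.
rewrite !enumE enum_ordSl /= filter_map.
have -> : [seq x <- enum 'I_m | preim (lift ord0) (mem A) x] =
          [seq x <- enum 'I_m | x \in tail_set A].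
  by apply: eq_filter => j; rewrite [in RHS]inE.
by case: ifP.
Qed.

Lemma card_cons_set m b (A : {set 'I_m}) : #|cons_set b A| = (b + #|A|)%N.
Proof.
rewrite cardE enum_tail_set cons_setK ord0_cons_set size_cat size_nseq size_map.
by rewrite -cardE.
Qed.

Lemma big_cons_set (R : Type) (idx : R) (op : Monoid.com_law idx) m
    (P : pred {set 'I_m.+1}) (F : {set 'I_m.+1} -> R) :
  \big[op/idx]_(A | P A) F A =
  op (\big[op/idx]_(A | P (cons_set true A)) F (cons_set true A))
     (\big[op/idx]_(A | P (cons_set false A)) F (cons_set false A)).
Proof.
rewrite (reindex (fun p : bool * {set 'I_m} => cons_set p.1 p.2)) /=.
  rewrite -(pair_big_dep xpredT (fun b A => P (cons_set b A))
    (fun b A => F (cons_set b A))) /=.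
  by rewrite big_bool.
exists (fun A : {set 'I_m.+1} => (ord0 \in A, tail_set A)) => [[b A] _|A _] /=.
  by rewrite ord0_cons_set cons_setK.
exact: tail_setK.
Qed.

(* The composition of [m + x] with partial sums [j + x] for [j] in [A]; the
   successor convention of [comp_set] is the case [x = 1]. *)
Definition shift_comp m x (A : {set 'I_m}) : seq nat :=
  pairmap (fun a b => b - a)%N 0%N (rcons [seq (j + x)%N | j : 'I_m <- enum A] (m + x)%N).

Lemma comp_setE m (A : {set 'I_m}) : comp_set A = shift_comp 1%N A.
Proof.
rewrite /comp_set /shift_comp addn1; congr (pairmap _ _ (rcons _ _)).
by apply: eq_map => j; rewrite addn1.
Qed.

Lemma pairmap_subD x y s :
  pairmap (fun a b => b - a)%N (y + x)%N [seq (j + x)%N | j <- s] =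
  pairmap (fun a b => b - a)%N y s.
Proof. by elim: s y => //= j s IHs y; rewrite subnDr IHs. Qed.

Lemma shift_comp0 x (A : {set 'I_0}) : shift_comp x A = [:: x].
Proof. by rewrite /shift_comp (_ : enum A = [::]) /= ?subn0 //; case: (enum A) => [|[]]. Qed.

(** [x] is the length of the current part so far. Position [ord0] either closes it, and the next
    part starts afresh at 1, or lengthens it by one. *)
Lemma shift_compS m x (A : {set 'I_m.+1}) :
  shift_comp x A =
  if ord0 \in A then x :: shift_comp 1%N (tail_set A) else shift_comp x.+1 (tail_set A).
Proof.
have eS : [seq (j + x)%N | j : 'I_m.+1 <- [seq lift ord0 j | j <- enum (tail_set A)]]
    = [seq (j + x.+1)%N | j : 'I_m <- enum (tail_set A)].
  by rewrite -map_comp; apply: eq_map => j /=; rewrite /bump /= addnS add1n addSn.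
rewrite /shift_comp enum_tail_set; case: ifP => _ /=; last by rewrite eS addSnnS.
rewrite eS subn0 add0n addSnnS; congr (_ :: _).
rewrite -(pairmap_subD x 0) map_rcons -map_comp add0n; congr (pairmap _ _ (rcons _ _)).
  by apply: eq_map => j /=; rewrite -addnA add1n.
by rewrite -addnA add1n.
Qed.

Lemma shift_comp_cons m x (A : {set 'I_m}) : exists c s, shift_comp x A = c :: s.
Proof. by rewrite /shift_comp; case: [seq _ | _ <- _] => [|c s] /=; eexists; eexists. Qed.

Lemma shift_compD m x y (A : {set 'I_m}) :
  shift_comp (x + y)%N A =
  (head 0 (shift_comp x A) + y)%N :: behead (shift_comp x A).
Proof.
elim: m x y A => [|m IHm] x y A; first by rewrite !shift_comp0.
by rewrite !shift_compS; case: ifP => //= _; rewrite -addSn IHm.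
Qed.

Lemma shift_comp_head m x (A : {set 'I_m}) : (0 < x)%N -> (0 < head 0 (shift_comp x A))%N.
Proof.
elim: m x A => [|m IHm] x A x0; first by rewrite shift_comp0.
by rewrite shift_compS; case: ifP => //= _; apply: IHm.
Qed.

Definition shift_lasts m x (K I : {set 'I_m}) : seq nat :=
  block_lasts (shift_comp x I) (shift_comp x K).

Lemma shift_lasts0 x (K I : {set 'I_0}) : (0 < x)%N -> shift_lasts x K I = [:: x].
Proof. by move=> x0; rewrite /shift_lasts !shift_comp0 block_lasts_eq. Qed.

(** If [ord0] lies in [I], hence in [K], it ends a block made of the entry [x] alone. If it lies in
    [K] only, [x] is an entry but not the last of its block, and is dropped. Otherwise both current
    parts grow. *)
Lemma shift_lastsS m x (K I : {set 'I_m.+1}) : (0 < x)%N -> I \subset K ->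
  shift_lasts x K I =
  if ord0 \in I then x :: shift_lasts 1%N (tail_set K) (tail_set I)
  else if ord0 \in K then shift_lasts 1%N (tail_set K) (tail_set I)
  else shift_lasts x.+1 (tail_set K) (tail_set I).
Proof.
move=> x0 /subsetP sIK; rewrite /shift_lasts !shift_compS.
have [/sIK -> | _] := ifP; first by rewrite block_lasts_eq.
case: ifP => // _; rewrite -add1n shift_compD.
have := shift_comp_head (tail_set I) (isT : (0 < 1)%N).
have [a [s ->]] := shift_comp_cons 1%N (tail_set I).
have [b [s' ->]] := shift_comp_cons 1%N (tail_set K).
by move=> a0; rewrite block_lasts_add.
Qed.

Definition prev_in m (b : bool) (U : {set 'I_m}) (j : 'I_m) : bool :=
  if val j is i.+1 then [exists x in U, val x == i] else b.

(* [b] tells whether the position preceding the first one belongs to [U]. *)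
Definition block_final m (b : bool) (I K U : {set 'I_m}) : bool :=
  [forall j, ((j \in U) ==> (j \notin K)) &&
             (prev_in b U j && (j \notin I) ==> (j \in U))].

Lemma prev_in_lift m b c (U : {set 'I_m}) (j : 'I_m) :
  prev_in b (cons_set c U) (lift ord0 j) = prev_in c U j.
Proof.
case: j => [[|i] lti]; rewrite /prev_in /=.
  apply/existsP/idP => [[x /andP[xU /eqP x0]] | c1].
    have e : x = ord0 by apply: val_inj.
    by rewrite e ord0_cons_set in xU.
  by exists ord0; rewrite ord0_cons_set c1.
apply/existsP/existsP => [[x /andP[xU /eqP xi]] | [x /andP[xU /eqP xi]]].
  case: (unliftP ord0 x) xU xi => [y|] -> //=; rewrite lift0_cons_set => yU [<-].
  by exists y; rewrite yU eqxx.
by exists (lift ord0 x); rewrite lift0_cons_set xU /= /bump /= xi.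
Qed.

Lemma block_final_cons m b c (I K : {set 'I_m.+1}) (U : {set 'I_m}) :
  block_final b I K (cons_set c U) =
  [&& c ==> (ord0 \notin K), b && (ord0 \notin I) ==> c &
      block_final c (tail_set I) (tail_set K) U].
Proof.
apply/forallP/and3P => [H | [H1 H2 /forallP H3] j].
  have /andP[] := H ord0; rewrite ord0_cons_set => H1 H2; split => //.
  apply/forallP=> j; have := H (lift ord0 j).
  by rewrite prev_in_lift lift0_cons_set !inE.
case: (unliftP ord0 j) => [i|] ->; last by rewrite ord0_cons_set H1.
by have := H3 i; rewrite prev_in_lift lift0_cons_set !inE.
Qed.

(** * Products of $r$-integers as generating functions of block-final sets *)

Section QintProduct.
Variables (k : comPzRingType) (r : k).

Definition final_sum m b (I K : {set 'I_m}) : k :=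
  \sum_(U | block_final b I K U) r ^+ #|U|.

Lemma final_sum0 b (I K : {set 'I_0}) : final_sum b I K = 1.
Proof.
rewrite /final_sum (big_pred1 set0) ?cards0 // => U /=.
rewrite (_ : U = set0) ?eqxx; first by apply/forallP; case.
by apply/setP; case.
Qed.

(** The first term collects the sets containing [ord0], excluded when [ord0] is in [K]; the second
    those avoiding it, excluded when a final segment in progress must continue. *)
Lemma final_sumS m b (I K : {set 'I_m.+1}) :
  final_sum b I K =
  (ord0 \notin K)%:R * r * final_sum true (tail_set I) (tail_set K) +
  (~~ (b && (ord0 \notin I)))%:R * final_sum false (tail_set I) (tail_set K).
Proof.
rewrite /final_sum big_cons_set; congr (_ + _).
  case: (boolP (ord0 \in K)) => K0; rewrite ?mul0r ?mul1r.
    by apply: big1 => U; rewrite block_final_cons K0.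
  rewrite mulr_sumr; apply: eq_big => U; rewrite ?block_final_cons ?K0 ?implybT //.
  by rewrite card_cons_set exprS.
case: (boolP (b && _)) => bI; rewrite ?mul0r ?mul1r.
  by apply: big1 => U; rewrite block_final_cons bI.
apply: eq_big => U; first by rewrite block_final_cons (negbTE bI).
by rewrite card_cons_set.
Qed.

Lemma qintS v : qint v.+1 r = 1 + r * qint v r.
Proof.
rewrite /qint big_ord_recl mulr_sumr; congr (_ + _).
by apply: eq_bigr => i _; rewrite /= /bump /= exprS.
Qed.

(** Here [x] positions of the current block have been passed since its start or its latest element
    of [K]. Either the set contains none of them ([final_sum false]), or it contains the last $i$ of
    them for some $1\le i\le x$, with total weight $r[x]_r$ ([final_sum true]). *)
Lemma prod_qint_shift_lasts m x (I K : {set 'I_m}) : I \subset K ->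
  \prod_(v <- shift_lasts x.+1 K I) qint v r =
  final_sum false I K + r * qint x r * final_sum true I K.
Proof.
elim: m x I K => [|m IHm] x I K sIK.
  by rewrite shift_lasts0 // big_seq1 !final_sum0 mulr1 qintS.
have sIK' : tail_set I \subset tail_set K.
  by apply/subsetP=> j; rewrite !inE; apply: (subsetP sIK).
have q0 : qint 0 r = 0 by rewrite /qint big_ord0.
rewrite shift_lastsS // !final_sumS /=; case: (boolP (ord0 \in I)) => [I0|I0].
  rewrite (subsetP sIK _ I0) /= !mul0r !mul1r !add0r big_cons IHm // q0 mulr0 mul0r.
  by rewrite addr0 qintS mulrDl mul1r.
case: (boolP (ord0 \in K)) => K0; rewrite IHm //= ?q0 !(mul0r, mul1r, mulr0, addr0, add0r) //.
rewrite qintS mulrDr mulr1 mulrDl addrA [X in X + _ = _]addrC.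
by rewrite -!mulrA [in RHS](mulrCA (qint x r)).
Qed.

End QintProduct.

(** * Sums over constrained subsets *)

(** Expanding the product chooses, for each [x], whether it is in [M]. *)
Lemma sum_expr_setE (k : comPzRingType) (T : finType) (a b : pred T) (z : k) :
  \sum_(M : {set T} | [forall x, if x \in M then a x else b x]) z ^+ #|M| =
  \prod_x ((a x)%:R * z + (b x)%:R).
Proof.
rewrite bigA_distr big_mkcond /=; apply: eq_bigr => M _; case: ifP => [/forallP H|].
  rewrite (eq_bigr (fun x => if x \in M then z else 1)).
    by rewrite -big_mkcond prodr_const.
  by move=> x _; have := H x; case: ifP => _ ->; rewrite ?mul1r.
move/negbT; rewrite negb_forall => /existsP[x Hx]; rewrite (bigD1 x) //=.
by move: Hx; case: ifP => _ /negbTE ->; rewrite ?mul0r ?mul0r.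
Qed.

(** The sum factors over the elements of [T], and each element of [B] outside [A] contributes
    $-1+1=0$. *)
Lemma sum_sign_interval (k : comPzRingType) (T : finType) (A B : {set T}) :
  A \subset B ->
  \sum_(M : {set T} | (A \subset M) && (M \subset B)) (-1) ^+ #|M| =
  (A == B)%:R * (-1) ^+ #|A| :> k.
Proof.
move=> sAB.
rewrite (eq_bigl (fun M : {set T} =>
  [forall x, if x \in M then x \in B else x \notin A])) => [|M]; last first.
  apply/andP/forallP => [[/subsetP AM /subsetP MB] x | H].
    by case: ifP => [/MB|/negbT xM] //; apply: contra xM => /AM.
  split; apply/subsetP=> x xA; have := H x; last by rewrite xA.
  by case: ifP => // _; rewrite xA.
rewrite sum_expr_setE; have [eAB | neAB] := eqVneq A B.
  rewrite mul1r -prodr_const [RHS]big_mkcond; apply: eq_bigr => x _; rewrite eAB.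
  by case: ifP => _; rewrite ?mul1r ?mul0r ?addr0 ?add0r.
have /subsetPn[x xB xA] : ~~ (B \subset A) by rewrite eqEsubset sAB in neAB.
by rewrite (bigD1 x) //= xB xA mul1r addNr !mul0r.
Qed.

(** * V-permutations *)

Section VPermutations.
Variable m : nat.
Implicit Types (L : {set 'I_m.+1}) (x y : 'I_m.+1).

(* Sorting by this key lists [L] in decreasing order, then its complement in
   increasing order. *)
Definition vkey L x : nat := if x \in L then (m - x)%N else (m.+1 + x)%N.

Lemma vkey_inj L : injective (vkey L).
Proof.
move=> x y; rewrite /vkey => e; apply: val_inj => /=.
by have := ltn_ord x; have := ltn_ord y; move: e; case: ifP; case: ifP; lia.
Qed.

(** The relative order of two letters depends only on the larger one: it comes first exactly when it
    is in [L]. *)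
Lemma vkey_lt L x y : x != y ->
  (vkey L x < vkey L y)%N = if (y < x)%N then x \in L else y \notin L.
Proof.
move=> /eqP nxy; have {}nxy : val x <> val y by move/val_inj.
rewrite /= in nxy; have := ltn_ord x; have := ltn_ord y; rewrite /vkey.
by case: (y \in L); case: (x \in L); case: (ltnP y x) => /=; lia.
Qed.

(** [rank_perm] sends a letter to its position; its inverse is the word itself. *)
Definition vperm L : 'S_m.+1 := ((rank_perm (@vkey_inj L))^-1)%g.

Lemma vpermV_lt L x y : ((vperm L)^-1 x < (vperm L)^-1 y)%g%N = (vkey L x < vkey L y)%N.
Proof. by rewrite /vperm invgK ltn_rank_perm. Qed.

(** A letter precedes the minimum exactly when it is in [L]; this turns the exponent of $-q$ into a
    cardinality. *)
Lemma vpermV0 L : ord0 \notin L -> ((vperm L)^-1 ord0)%g = #|L| :> nat.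
Proof.
move=> L0; rewrite /vperm invgK rank_permE; apply: eq_card => x; rewrite inE.
have [-> | nx0] := eqVneq x ord0; first by rewrite ltnn (negbTE L0).
by rewrite vkey_lt //= lt0n (nx0 : (x : nat) != 0%N).
Qed.

Definition left_of_min (p : 'S_m.+1) : {set 'I_m.+1} :=
  [set x | (p^-1 x < p^-1 ord0)%g%N].

Lemma vpermK L : ord0 \notin L -> left_of_min (vperm L) = L.
Proof.
move=> L0; apply/setP=> x; rewrite inE vpermV_lt.
have [-> | nx0] := eqVneq x ord0; first by rewrite ltnn (negbTE L0).
by rewrite vkey_lt //= lt0n (nx0 : (x : nat) != 0%N).
Qed.

Lemma Vperm_vperm L : ord0 \notin L -> Vperm (vperm L).
Proof.
move=> L0; set p := vperm L; apply/existsP; exists ((p^-1)%g ord0).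
apply/forallP=> j; set a := lift ord_max j; set b := lift ord0 j.
have ea : a = j :> nat by rewrite /a /= /bump leqNgt ltn_ord.
have eb : b = j.+1 :> nat by [].
have nab : p a != p b.
  by rewrite (inj_eq perm_inj); apply: contra_eq_neq eb => <-; rewrite ea neq_ltn ltnSn.
have inL x : (p x \in L) = (x < p^-1 ord0)%g%N.
  by rewrite -{1}(vpermK L0) inE -/p permK.
have := vpermV_lt L (p a) (p b); rewrite !permK vkey_lt // !inL ea eb ltnSn.
have : val (p a) <> val (p b) by move/val_inj/eqP; apply/negP.
(* In the boundary case $j+1=t$ the letter [p b] is the minimum, which forces the descent there. *)
have : j.+1 = (p^-1 ord0)%g -> p b = 0%N :> nat.
  by rewrite -eb => /val_inj ->; rewrite permKV.
move: ((p^-1)%g ord0) => t /=.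
by case: (ltnP j t); case: (ltnP j.+1 t); case: (ltnP (p b) (p a)) => /=; lia.
Qed.

Lemma Vperm_monotone (p : 'S_m.+1) (t : 'I_m.+1) :
  (forall j : 'I_m, if (j < t)%N then (p (lift ord0 j) < p (lift ord_max j))%N
     else (p (lift ord_max j) < p (lift ord0 j))%N) ->
  (forall a b : 'I_m.+1, (a < b)%N -> (b <= t)%N -> (p b < p a)%N) /\
  (forall a b : 'I_m.+1, (a < b)%N -> (t <= a)%N -> (p a < p b)%N).
Proof.
move=> H.
have step (a b : 'I_m.+1) : b = a.+1 :> nat ->
    if (a < t)%N then (p b < p a)%N else (p a < p b)%N.
  move=> eb; have ltam : (a < m)%N by have := ltn_ord b; rewrite eb.
  have ea : a = lift ord_max (Ordinal ltam).
    by apply: val_inj; rewrite /= /bump leqNgt ltam.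
  have {}eb : b = lift ord0 (Ordinal ltam) by apply: val_inj; rewrite /= eb.
  by have := H (Ordinal ltam); rewrite -ea -eb.
split=> a b; move eb: (nat_of_ord b) => n; elim: n b eb => // n IHn b eb lab.
  move=> lbt; have ltnm : (n < m.+1)%N by have := ltn_ord b; lia.
  have := @step (Ordinal ltnm) b eb; rewrite /= (_ : (n < t)%N) => [lt1|]; last by lia.
  have [lan | nan] := ltnP a n; last first.
    by rewrite (_ : a = Ordinal ltnm) //; apply: val_inj => /=; lia.
  by apply: ltn_trans lt1 _; apply: IHn => //=; lia.
move=> lta; have ltnm : (n < m.+1)%N by have := ltn_ord b; lia.
have := @step (Ordinal ltnm) b eb; rewrite /= ltnNge (_ : (t <= n)%N) => [lt1|]; last by lia.
have [lan | nan] := ltnP a n; last first.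
  by rewrite (_ : a = Ordinal ltnm) //; apply: val_inj => /=; lia.
by apply: ltn_trans lt1; apply: IHn.
Qed.

Lemma left_of_minK (p : 'S_m.+1) : Vperm p -> vperm (left_of_min p) = p.
Proof.
case/existsP=> t /forallP /Vperm_monotone[decr incr].
(* If the minimum stood elsewhere, monotonicity would put a smaller letter at [t]. *)
have pt : p t = ord0.
  have [lt|lt|/val_inj <-] := ltngtP ((p^-1)%g ord0) t; last exact: permKV.
    by have := decr _ _ lt (leqnn _); rewrite permKV.
  by have := incr _ _ lt (leqnn _); rewrite permKV.
have t0 : (p^-1 ord0)%g = t by rewrite -pt permK.
apply: invg_inj; apply: perm_ltn_inj => x y; rewrite vpermV_lt.
have [-> | nxy] := eqVneq x y; first by rewrite !ltnn.
rewrite vkey_lt // !inE t0.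
set a := (p^-1)%g x; set b := (p^-1)%g y.
have -> : x = p a by rewrite permKV.
have -> : y = p b by rewrite permKV.
have nab : val a <> val b by move/val_inj/perm_inj/eqP; apply/negP.
have := decr a b; have := decr b a; have := incr a b; have := incr b a.
have : (p b < p a)%N -> (p a < p b)%N -> False by lia.
rewrite /= in nab *.
by case: (ltngtP a b); case: (ltngtP a t); case: (ltngtP b t); case: (ltnP (p b) (p a)) => /=; lia.
Qed.


Lemma big_Vperm (R : Type) (idx : R) (op : Monoid.com_law idx) (F : 'S_m.+1 -> R) :
  \big[op/idx]_(p | Vperm p) F p = \big[op/idx]_(L : {set 'I_m.+1} | ord0 \notin L) F (vperm L).
Proof.
rewrite (reindex_onto vperm left_of_min left_of_minK).
apply: eq_bigl => L; case: (boolP (ord0 \in L)) => L0 /=.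
  apply/negbTE/nandP; right; apply: contraL L0 => /eqP <-.
  by rewrite inE ltnn.
by rewrite Vperm_vperm // vpermK ?eqxx.
Qed.

End VPermutations.

(** * The coefficients of V B_I *)

(* [T] meets each block of positions cut out by [I] in an initial segment. *)
Definition block_initial m (I T : {set 'I_m}) : bool :=
  [forall i : 'I_m, forall j : 'I_m,
     [&& val j == i.+1, i \notin T & j \in T] ==> (j \in I)].

Section Coefficient.
Variables (k : comPzRingType) (m : nat).
Implicit Types (u t : 'S_m.+1) (I J K M : {set 'I_m}).

(** With [L = u @: M], the set [M] consists of positions of [u]. At [j] outside [I] the two letters
    must keep their order in [vperm L], which the larger one decides: at a descent the first must be
    in [L], at an ascent the second must not be. *)
Definition forced_in I u : {set 'I_m.+1} := [set lift ord_max j | j in Des u :\: I].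

Definition forced_out I u : {set 'I_m.+1} :=
  (u^-1)%g ord0 |: [set lift ord0 j | j in ~: (I :|: Des u)].

Lemma lift_max_val (j : 'I_m) : lift ord_max j = j :> nat.
Proof. by rewrite /= /bump leqNgt ltn_ord. Qed.

Lemma lift_max_neq0 (j : 'I_m) : lift ord_max j != lift ord0 j.
Proof.
by apply/eqP=> /(congr1 (@nat_of_ord _)); rewrite lift_max_val /= /bump /=; lia.
Qed.

Lemma notin_Des u j : (j \notin Des u) = (u (lift ord_max j) < u (lift ord0 j))%N.
Proof.
by rewrite inE -leqNgt ltn_neqAle val_eqE (inj_eq perm_inj) lift_max_neq0.
Qed.

Lemma Des_mul_subset u t I :
  (Des (u * t) \subset I) =
  [forall (j | j \notin I), (t (u (lift ord_max j)) < t (u (lift ord0 j)))%N].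
Proof.
apply/subsetP/forall_inP => [H j jI | H j].
  by rewrite -!permM -notin_Des; apply: contra jI; apply: H.
by apply: contraLR => /H; rewrite -!permM -notin_Des.
Qed.

Lemma vperm_Des_subset I u (M : {set 'I_m.+1}) :
  (ord0 \notin u @: M) && (Des (u * (vperm (u @: M))^-1) \subset I) =
  [forall x, if x \in M then x \notin forced_out I u else x \notin forced_in I u].
Proof.
have u0 : (ord0 \in u @: M) = ((u^-1)%g ord0 \in M).
  by rewrite -{1}(permKV u ord0) mem_imset //; apply: perm_inj.
have cond j : ((vperm (u @: M))^-1%g (u (lift ord_max j)) <
       (vperm (u @: M))^-1%g (u (lift ord0 j)))%N =
    if j \in Des u then lift ord_max j \in M else lift ord0 j \notin M.
  rewrite vpermV_lt vkey_lt; last by rewrite (inj_eq perm_inj) lift_max_neq0.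
  by rewrite inE !(mem_imset _ _ (@perm_inj _ u)).
rewrite Des_mul_subset u0; apply/andP/forallP => [[M0 /forall_inP H] x | H].
  case: (boolP (x \in M)) => xM.
    rewrite !inE negb_or; apply/andP; split; first by apply: contraNneq M0 => <-.
    apply/imsetP=> -[j]; rewrite !inE negb_or => /andP[jI jD] ex.
    by have := H j jI; rewrite cond inE (negbTE jD) -ex xM.
  apply/imsetP=> -[j]; rewrite inE => /andP[jI jD] ex.
  by have := H j jI; rewrite cond jD -ex (negbTE xM).
split.
  by have := H ((u^-1)%g ord0); case: ifP; rewrite // !inE eqxx.
apply/forall_inP=> j jI; rewrite cond; case: (boolP (j \in Des u)) => jD.
  have := H (lift ord_max j); case: ifP => // _.
  by rewrite mem_imset ?inE ?jI //; [rewrite inE in jD; rewrite jD | apply: lift_inj].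
have := H (lift ord0 j); case: ifP => // _; rewrite in_setU1 mem_imset; last exact: lift_inj.
by rewrite in_setC in_setU (negbTE jI) (negbTE jD) orbT.
Qed.

(** A clash is a position that is the first of a descent and the second of an ascent, both outside
    [I]: a failure of [block_initial]. The position of the minimum never clashes, as no descent
    starts there. *)
Lemma forced_disjoint I u :
  [disjoint forced_in I u & forced_out I u] = block_initial I (I :|: Des u).
Proof.
apply/idP/idP => [dis | /forallP good].
  apply/forallP=> i; apply/forallP=> j; apply/implyP => /and3P[/eqP eij iT jT].
  apply: contraT => jI; have jin : lift ord_max j \in forced_in I u.
    rewrite mem_imset ?in_setD ?jI; last exact: lift_inj.
    by rewrite in_setU (negbTE jI) in jT.
  have := disjointFr dis jin; rewrite (_ : lift ord_max j = lift ord0 i).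
    by rewrite in_setU1 mem_imset ?in_setC ?iT ?orbT //; apply: lift_inj.
  by apply: ord_inj; rewrite lift_max_val eij.
rewrite disjoints_subset; apply/subsetP => x /imsetP[j]; rewrite in_setD => /andP[jI jD] ->.
rewrite in_setC in_setU1 negb_or; apply/andP; split.
  by apply: contraTneq jD => e; rewrite inE -leqNgt e permKV.
apply/imsetP=> -[i]; rewrite in_setC => iT e; have /forallP/(_ j) := good i.
rewrite iT in_setU jD orbT (negbTE jI) !andbT implybF => /negP; apply.
by rewrite -[val j](lift_max_val j) e.
Qed.

Lemma card_forced_in I u : #|forced_in I u| = #|Des u :\: I|.
Proof. by rewrite card_imset //; apply: lift_inj. Qed.

Lemma card_forced_out I u : #|forced_out I u| = (m - #|I :|: Des u|).+1.
Proof.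
rewrite /forced_out cardsU1 card_imset; last exact: lift_inj.
rewrite [#|~: _|]cardsCs setCK card_ord (_ : (_ \notin _) = true) //.
apply/imsetP=> -[j]; rewrite in_setC in_setU negb_or => /andP[_].
by rewrite notin_Des => + e; rewrite -e permKV.
Qed.

(** The factor at [x] is $z$ on [A] only, $1$ on [B] only, $1+z$ outside both and $0$ on their
    intersection. *)
Lemma prod_forced (T : finType) (A B : {set T}) (z : k) :
  \prod_x ((x \notin B)%:R * z + (x \notin A)%:R) =
  [disjoint A & B]%:R * z ^+ #|A| * (1 + z) ^+ #|~: (A :|: B)|.
Proof.
have [dis | ] := boolP [disjoint A & B]; last first.
  rewrite -setI_eq0 => /set0Pn[x]; rewrite inE => /andP[xA xB].
  by rewrite (bigD1 x) //= xA xB !mul0r addr0 mul0r.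
rewrite mul1r -!prodr_const (big_mkcond (mem A)) (big_mkcond (mem (~: _))) -big_split.
apply: eq_bigr => x _ /=; rewrite !inE.
have := disjointFr dis (x := x); case: (x \in A) => [-> //|_] /=.
  by rewrite mul1r mulr1 addr0.
by case: (x \in B); rewrite /= ?mul0r ?mul1r ?add0r // addrC.
Qed.

Lemma gmul_Vel_Bel (q : k) I u :
  gmul (Vel m q) (Bel k I) u =
  (block_initial I (I :|: Des u))%:R * (- q) ^+ #|Des u :\: I| * (1 - q) ^+ #|I| :> k.
Proof.
pose F (p : 'S_m.+1) : k := (- q) ^+ (p^-1 ord0)%g * (Des (u * p^-1)%g \subset I)%:R.
rewrite gmulE (eq_bigr (fun p => if Vperm p then F p else 0)) => [|p _]; last first.
  by rewrite VelE BelE; case: ifP; rewrite ?mul0r.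
rewrite -big_mkcond big_Vperm (reindex_inj (imset_inj (@perm_inj _ u))) /=.
transitivity (\sum_(M : {set 'I_m.+1} | [forall x, if x \in M then x \notin forced_out I u
    else x \notin forced_in I u]) (- q) ^+ #|M|).
  rewrite big_mkcond [RHS]big_mkcond; apply: eq_bigr => M _.
  rewrite -vperm_Des_subset /F; case: ifP => //= M0; rewrite vpermV0 ?M0 //.
  by rewrite card_imset; [case: ifP; rewrite ?mulr1 ?mulr0 | apply: perm_inj].
rewrite sum_expr_setE (prod_forced (forced_in I u)) forced_disjoint card_forced_in.
case: (boolP (block_initial _ _)) => good; rewrite ?mul0r // !mul1r; congr (_ * _ ^+ _).
(* The number of free positions is $(m+1)-|D\setminus I|-(m-|I\cup D|+1)=|I|$, where $D$ is
   [Des u]. *)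
have := cardsC (forced_in I u :|: forced_out I u); rewrite card_ord.
have := cardsUI (forced_in I u) (forced_out I u).
have -> : forced_in I u :&: forced_out I u = set0.
  by apply/eqP; rewrite setI_eq0 forced_disjoint.
rewrite cards0 card_forced_in card_forced_out.
have := max_card (mem (I :|: Des u)); rewrite card_ord.
have := subset_leq_card (subsetIr I (Des u)).
have := subset_leq_card (subsetIl I (Des u)).
rewrite (cardsU I) cardsD [Des u :&: I]setIC.
move: #|I| #|Des u| #|I :&: Des u| #|_ :|: _| #|~: _| => a b c d e; lia.
Qed.

End Coefficient.

(** * The B-expansion *)

(** Complementation exchanges final and initial segments of blocks; no position precedes the first,
    hence [false]. *)
Lemma block_finalC m (I K T : {set 'I_m}) :
  block_final false I K (~: T) = (K \subset T) && block_initial I T.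
Proof.
apply/forallP/andP => [H | [/subsetP KT /forallP good] j].
  split.
    apply/subsetP=> j jK; have /andP[+ _] := H j.
    by rewrite in_setC jK implybF negbK.
  apply/forallP=> i; apply/forallP=> j; apply/implyP=> /and3P[/eqP eij iT jT].
  have /andP[_] := H j; rewrite in_setC jT implybF negb_and negbK => /orP[|//].
  rewrite /prev_in eij negb_exists => /forallP/(_ i).
  by rewrite in_setC iT eqxx.
rewrite in_setC; apply/andP; split; first by apply/implyP; apply: contra; apply: KT.
apply/implyP=> /andP[]; rewrite /prev_in; case ej: (val j) => [//|n] /existsP[i].
rewrite in_setC => /andP[iT /eqP ei]; apply: contra => jT.
by have /forallP/(_ j)/implyP := good i; apply; rewrite ej ei eqxx iT jT.
Qed.

Lemma prod_qint_last_entries (k : comPzRingType) (r : k) m (I K : {set 'I_m}) :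
  I \subset K ->
  \prod_(v <- last_entries K I) qint v r =
  \sum_(T : {set 'I_m} | (K \subset T) && block_initial I T) r ^+ (m - #|T|).
Proof.
move=> sIK; rewrite /last_entries !comp_setE.
have := prod_qint_shift_lasts r 0 sIK; rewrite /shift_lasts /block_lasts => ->.
(* At the start [x = 0], so the term with $[0]_r$ vanishes. *)
rewrite /qint big_ord0 mulr0 mul0r addr0 /final_sum (reindex_inj (@setC_inj _)) /=.
apply: eq_big => T; first exact: block_finalC.
by rewrite cardsCs setCK card_ord.
Qed.

(** The left side is the coefficient, in the claimed expansion, of any permutation with descent set
    [J]. *)
Lemma sum_up_coef (k : comPzRingType) (q qinv : k) m (I J : {set 'I_m}) :
  q * qinv = 1 ->
  \sum_(K : {set 'I_m} | (I \subset K) && (J \subset K))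
     (-1) ^+ #|K| * q ^+ m * (1 - qinv) ^+ #|I|
       * \prod_(v <- last_entries K I) qint v qinv =
  (block_initial I (I :|: J))%:R * (- q) ^+ #|J :\: I| * (1 - q) ^+ #|I|.
Proof.
move=> hq.
have qm (T : {set 'I_m}) : q ^+ m * qinv ^+ (m - #|T|) = q ^+ #|T|.
  have leT : (#|T| <= m)%N by rewrite -[X in (_ <= X)%N]card_ord max_card.
  by rewrite -{1}(subnKC leT) exprD -mulrA -exprMn hq expr1n mulr1.
transitivity ((1 - qinv) ^+ #|I| *
    \sum_(K : {set 'I_m} | I :|: J \subset K)
    \sum_(T : {set 'I_m} | (K \subset T) && block_initial I T)
      (q ^+ #|T| * (-1) ^+ #|K|)).
  rewrite mulr_sumr; apply: eq_big => K; first by rewrite subUset.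
  case/andP=> IK _; rewrite prod_qint_last_entries // -mulr_suml.
  under [in RHS]eq_bigr => T _ do rewrite -qm.
  by rewrite -mulr_sumr -!mulrA mulrC -!mulrA mulrCA.
rewrite (exchange_big_dep (fun T : {set 'I_m} => (I :|: J \subset T) && block_initial I T)) /=; last first.
  by move=> K T IJK /andP[KT ->]; rewrite (subset_trans IJK KT).
under eq_bigr => T /andP[IJT good].
  rewrite -mulr_sumr (eq_bigl (fun K : {set 'I_m} => (I :|: J \subset K) && (K \subset T))).
    rewrite sum_sign_interval //; over.
  by move=> K; rewrite good andbT.
have cIJ : #|I :|: J| = (#|I| + #|J :\: I|)%N.
  have := subset_leq_card (subsetIr I J); rewrite cardsU cardsD (setIC J I).
  by move: #|I| #|J| #|I :&: J| => a b c; lia.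
transitivity ((1 - qinv) ^+ #|I| * ((block_initial I (I :|: J))%:R * (- q) ^+ #|I :|: J|)).
  congr (_ * _); case: (boolP (block_initial I (I :|: J))) => good.
    rewrite (bigD1 (I :|: J)) ?subxx //= eqxx !mul1r -exprMn mulrN1 big1 ?addr0 //.
    by move=> T /andP[_ /negbTE]; rewrite eq_sym => ->; rewrite mul0r mulr0.
  rewrite mul0r big1 // => T /andP[_ goodT]; case: eqP => [e|_]; last by rewrite mul0r mulr0.
  by rewrite e goodT in good.
(* Of the $|I\cup J|$ factors $-q$, as many as $|I|$ combine with the factors $1-q^{-1}$ into
   $1-q$. *)
have eq1 : (1 - qinv) * (- q) = 1 - q.
  by rewrite mulrBl mul1r mulrN opprK mulrC hq addrC.
rewrite cIJ exprD -eq1 exprMn !mulrA [(1 - qinv) ^+ _ * _]mulrC -!mulrA; congr (_ * _).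
by rewrite [RHS]mulrC -!mulrA.
Qed.

(** * Uniqueness of the expansion *)

Lemma Des_surj m (J : {set 'I_m}) : exists u : 'S_m.+1, Des u = J.
Proof.
pose asc (x : nat) := #|[set i : 'I_m | (i \notin J) && (i < x)%N]|.
(* The number of positions outside [J] before [x] dominates the key, and ties are broken by
   decreasing position: the word has decreasing runs, each with larger letters than the one
   before. *)
pose key (x : 'I_m.+1) := (m.+1 * asc x + (m - x))%N.
have asc_le x y : (x <= y)%N -> (asc x <= asc y)%N.
  move=> lexy; apply: subset_leq_card; apply/subsetP=> i; rewrite !inE.
  by case/andP=> -> /= /leq_trans; apply.
have key_inj : injective key.
  have aux (x y : 'I_m.+1) : (x < y)%N -> key x <> key y.
    move=> ltxy; have := asc_le _ _ (ltnW ltxy); rewrite leq_eqVlt /key.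
    have := ltn_ord x; have := ltn_ord y => ltym ltxm /orP[/eqP->|]; first by lia.
    by move: (asc x) (asc y) => a b; nia.
  move=> x y e; apply: ord_inj; case: (ltngtP x y) => // /aux; first by rewrite e.
  by rewrite e.
exists (rank_perm key_inj); apply/setP=> j; rewrite inE ltn_rank_perm /key.
rewrite lift_max_val (_ : lift ord0 j = j.+1 :> nat) //.
have ltjm := ltn_ord j; case: (boolP (j \in J)) => jJ.
  have -> : asc j.+1 = asc j.
    apply: eq_card => i; rewrite !inE ltnS leq_eqVlt; case: eqP => //= /ord_inj ->.
    by rewrite jJ.
  by lia.
have : (asc j < asc j.+1)%N.
  apply: proper_card; apply/properP; split; last by exists j; rewrite !inE ?jJ ?ltnSn ?ltnn ?andbF.
  by apply/subsetP=> i; rewrite !inE => /andP[-> /ltnW].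
by move: (asc j) (asc j.+1) => a b; nia.
Qed.

(** The system is triangular for inclusion: induction from the full set downwards isolates [c J]. *)
Lemma upper_sum_inj (k : comPzRingType) (T : finType) (c c' : {ffun {set T} -> k}) :
  (forall J : {set T}, \sum_(K : {set T} | J \subset K) c K =
                       \sum_(K : {set T} | J \subset K) c' K) -> c = c'.
Proof.
move=> H; apply/ffunP=> J; have [n] := ubnP #|~: J|; elim: n J => // n IHn J; rewrite ltnS => leJ.
have := H J; rewrite (bigD1 J) // [in RHS](bigD1 J) //=.
have -> : \sum_(K : {set T} | (J \subset K) && (K != J)) c K =
          \sum_(K : {set T} | (J \subset K) && (K != J)) c' K.
  apply: eq_bigr => K /andP[JK nKJ]; apply: IHn; apply: leq_trans leJ.
  by apply: proper_card; rewrite properC properEneq eq_sym nKJ.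
exact: addIr.
Qed.

Lemma BexpansionP (k : comPzRingType) m (f : galg k m) (c : {ffun {set 'I_m} -> k}) :
  Bexpansion f c <-> forall u, f u = \sum_(K : {set 'I_m} | Des u \subset K) c K :> k.
Proof.
have E u : (\sum_K c K *: Bel k K : galg k m) u = \sum_(K : {set 'I_m} | Des u \subset K) c K :> k.
  rewrite sum_ffunE [RHS]big_mkcond; apply: eq_bigr => K _; rewrite ffunE BelE.
  by case: ifP => _; [apply: mulr1 | apply: mulr0].
split=> [-> u | H]; first exact: E.
by apply/ffunP=> u; rewrite H -E.
Qed.

(* n = m.+1, and qinv is the inverse of q. *)
Theorem theorem2p4 (k : comPzRingType) (m : nat) (q qinv : k)
  (hq : q * qinv = 1) (I : {set 'I_m}) :
  exists c : {ffun {set 'I_m} -> k},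
    unique (Bexpansion (gmul (Vel m q) (Bel k I))) c /\
    forall K : {set 'I_m},
      (~~ (I \subset K) -> c K = 0) /\
      (I \subset K ->
         c K = (-1) ^+ #|K| * q ^+ m * (1 - qinv) ^+ #|I|
               * \prod_(v <- last_entries K I) qint v qinv).
Proof.
exists [ffun K : {set 'I_m} => if I \subset K
  then (-1) ^+ #|K| * q ^+ m * (1 - qinv) ^+ #|I|
       * \prod_(v <- last_entries K I) qint v qinv
  else 0].
split; last by move=> K; rewrite ffunE; split=> [/negbTE ->|->].
set c := [ffun _ => _].
have exp_c : Bexpansion (gmul (Vel m q) (Bel k I)) c.
  apply/BexpansionP=> u; rewrite gmul_Vel_Bel -(sum_up_coef _ _ hq) [RHS]big_mkcond.
  rewrite [LHS]big_mkcond; apply: eq_bigr => K _; rewrite ffunE.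
  by case: (I \subset K); case: (_ \subset K).
(* Every [J] is some [Des u], so the coefficients of the product determine the sum over the [K]
   containing any given [J]. *)
split=> // c' exp_c'; apply: upper_sum_inj => J.
have [u <-] := Des_surj J.
by move/BexpansionP: exp_c => <-; move/BexpansionP: exp_c' => <-.
Qed.
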